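(* Let $\lambda>0$, $\theta>0$, $0<\alpha<1$, and let $N^{\alpha,\theta}(t)$, $t\ge0$, be the tempered (relativistic) Poisson process (defined in the context). Then for every $t>0$ and every integer $m\ge 0$, $$\Pr\{N^{\alpha,\theta}(t)=m\}=\frac{(-1)^m}{m!}\,\frac{\lambda^m e^{\theta^\alpha t}}{(\theta+\lambda)^m}\sum_{k=0}^\infty\frac{\bigl(-t(\lambda+\theta)^\alpha\bigr)^k}{k!}\,\frac{\Gamma(\alpha k+1)}{\Gamma(\alpha k+1-m)} .$$
   Context: The process $N^{\alpha,\theta}$ is the non-negative integer-valued process with $N^{\alpha,\theta}(0)=0$ and independent and stationary increments, such that as $dt\downarrow0$, with $N^{\alpha,\theta}[t,t+dt)$ the increment over $[t,t+dt)$, $$\Pr\{N^{\alpha,\theta}[t,t+dt)=k\}=\begin{cases} dt\,\dfrac{\lambda^k}{k!}\displaystyle\int_0^\infty e^{-\lambda s}s^k\,\nu(ds)+o(dt), & k\ge 1,\\[2mm] 1-dt\displaystyle\int_0^\infty(1-e^{-\lambda s})\,\nu(ds)+o(dt), & k=0,\end{cases}\qquad \nu(ds)=\frac{\alpha s^{-\alpha-1}e^{-\theta s}}{\Gamma(1-\alpha)}\,ds.$$ For each $t$, it has the same law as $N(H^{\alpha,\theta}(t))$, where $N$ is a homogeneous Poisson process of rate $\lambda$ and $H^{\alpha,\theta}$ is an independent tempered stable subordinator, $\mathbb{E}e^{-\mu H^{\alpha,\theta}(t)}=e^{-t[(\mu+\theta)^\alpha-\theta^\alpha]}$. Convention: $1/\Gamma(x)=0$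 when $x\in\{0,-1,-2,\dots\}$. *)

(* Defs.v *)
From HB Require Import structures.
From mathcomp Require Import all_boot all_order all_algebra.
From mathcomp Require Import all_classical all_reals all_analysis.

Set Implicit Arguments.
Unset Strict Implicit.
Unset Printing Implicit Defensive.

Import Order.TTheory GRing.Theory Num.Theory.
Import numFieldNormedType.Exports.

Local Open Scope classical_set_scope.
Local Open Scope ring_scope.

Definition euler_gamma (R : realType) (x : R) : R :=
  \int[lebesgue_measure]_(s in `]0%R, +oo[) (s `^ (x - 1) * expR (- s)).

(* The number of unit shifts that bring x into the half-line ]0, +oo[. *)
Definition gamma_shift (R : realType) (x : R) : nat :=
  if 0 < x then 0%N else (Num.truncn (- x)).+1.

(* The real Gamma function: Euler's integral on ]0, +oo[, continued by the
   functional equation Gamma x = Gamma (x + n) / (x (x + 1) ... (x + n - 1)).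
   At a pole x = 0, -1, -2, ... the product vanishes and, since 0^-1 = 0 in
   MathComp, Gamma x = 0; hence (Gamma x)^-1 = 0 there, which is the usual
   convention 1 / Gamma x = 0. *)
Definition Gamma (R : realType) (x : R) : R :=
  euler_gamma (x + (gamma_shift x)%:R)
    / \prod_(i < gamma_shift x) (x + i%:R).

Definition tempered_density (R : realType) (alpha theta s : R) : R :=
  alpha * s `^ (- alpha - 1) * expR (- theta * s) / Gamma (1 - alpha).

Definition tempered_integral (R : realType) (alpha theta : R) (f : R -> R) : R :=
  \int[lebesgue_measure]_(s in `]0%R, +oo[)
    (f s * tempered_density alpha theta s).

(* Increments are taken in int: subtraction on nat is truncated. *)
Definition increment (R : realType) (T : Type) (N : R -> T -> nat) (s t : R)
    (w : T) : int := (N t w)%:Z - (N s w)%:Z.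

(* Only times t >= 0 are constrained; N t for t < 0 is irrelevant. *)
Record tempered_poisson (R : realType) (d : measure_display)
    (T : measurableType d) (P : probability T R) (lambda alpha theta : R)
    (N : R -> {RV P >-> nat}) : Prop := TemperedPoisson {
  tp_start : forall w, N 0 w = 0%N ;
  (* Every set of integers is allowed as B i, int being discrete. *)
  tp_independent : forall (n : nat) (t : nat -> R) (B : nat -> set int),
    0 <= t 0%N -> (forall i, (i < n)%N -> t i <= t i.+1) ->
    P [set w | forall i, (i < n)%N -> B i (increment N (t i) (t i.+1) w)] =
    (\prod_(i < n) P [set w | B i (increment N (t i) (t i.+1) w)])%E ;
  tp_stationary : forall (s h : R) (B : set int), 0 <= s -> 0 <= h ->
    P [set w | B (increment N s (s + h) w)] =
    P [set w | B (increment N 0 h w)] ;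
  (* Quantified over all dt, a Landau equation is the equality of functions that
     says exactly that the error is o(dt) as dt decreases to 0; it carries no
     information on any individual dt, in particular on dt <= 0. *)
  tp_jump : forall (t : R) (k : nat), 0 <= t -> (1 <= k)%N -> forall dt : R,
    fine (P [set w | increment N t (t + dt) w = k%:Z]) =
      dt * (lambda ^+ k / k`!%:R *
        tempered_integral alpha theta (fun s => expR (- lambda * s) * s ^+ k))
      +o_(dt \near 0^'+) dt ;
  tp_nojump : forall t : R, 0 <= t -> forall dt : R,
    fine (P [set w | increment N t (t + dt) w = 0]) =
      (1 - dt * tempered_integral alpha theta (fun s => 1 - expR (- lambda * s)))
      +o_(dt \near 0^'+) dt
}.

(* Main.v *)
Require Import Defs.
From HB Require Import structures.
From mathcomp Require Import all_boot all_order all_algebra.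
From mathcomp Require Import all_classical all_reals all_analysis.
From mathcomp Require Import measurable_realfun zify ring lra.

Set Implicit Arguments.
Unset Strict Implicit.
Unset Printing Implicit Defensive.

Import Order.TTheory GRing.Theory Num.Theory.
Import numFieldNormedType.Exports.

Local Open Scope classical_set_scope.
Local Open Scope ring_scope.

(** The laws p_m(t) = P (N t = m) and the announced sums solve the same
    triangular linear system of differential equations

      f_m'(t) = r_0 f_m(t) + r_1 f_(m-1)(t) + ... + r_m f_0(t),   t > 0,

    with the same limits at 0, and such a system has only one solution
    ([triangular_ode_unique]).  In generating-function terms both sides have
    sum_m u^m f_m(t) = exp (t * sum_j r_j u^j), where

      sum_j r_j u^j = theta^alpha - (theta + lambda - lambda u)^alpha,

    and the coefficients r_j ([rate]) come from Newton's binomial series.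

    The process.  Independence and stationarity of the increments over [0, s]
    and [s, s + h] make p a convolution semigroup ([prob_convolution]); increments
    are almost surely nonnegative because each has the law of some N h.  The
    behaviour at small times then gives the system for p ([is_derive_prob]), with
    r_0 and r_k the integrals against the Levy density.  Those are evaluated by
    Gamma integrals: directly for k >= 1 ([jump_rateE]), after an integration by
    parts for k = 0 ([nojump_rateE]).

    The sums.  By the functional equation, Gamma (y + 1) / Gamma (y + 1 - m) is the
    falling factorial y (y - 1) ... (y - m + 1) ([Gamma_ratio]), so up to explicit
    factors f_m is an exponential generating series in z with coefficients
    binomial (alpha k, m).  Differentiating in z shifts k to k + 1, and
    Chu-Vandermonde ([gbinD]) expands binomial (alpha + alpha k, m) in the
    binomial (alpha k, m - j): this is the system for f
    ([is_derive_tempered_pmf]). *)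

(** * Integration over the half-line by antiderivatives *)

Section improper_integrals.
Variable R : realType.
Notation mu := (@lebesgue_measure R).
Implicit Types (f F : R -> R) (a : R).

Lemma continuous_itv0y_measurable f :
  (forall s : R, 0 < s -> {for s, continuous f}) ->
  measurable_fun (`]0, +oo[ : set R) f.
Proof.
move=> cf; apply: open_continuous_measurable_fun => //.
by move=> s; rewrite inE/= in_itv/= andbT; exact: cf.
Qed.

Lemma bigcup_itv0y a : 0 < a ->
  \bigcup_n `[a / n.+1%:R, +oo[%classic = `]0, +oo[%classic :> set R.
Proof.
move=> a0; apply/seteqP; split=> s /=.
  move=> [n _] /=; rewrite !in_itv/= !andbT.
  by apply: lt_le_trans; rewrite divr_gt0.
rewrite in_itv/= andbT => s0.
exists (Num.truncn (a / s)) => //=; rewrite in_itv/= andbT.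
rewrite ler_pdivrMr// mulrC -ler_pdivrMr//.
exact/ltW/truncnS_gt.
Qed.

Lemma ge0_integral_itv0y_cvg f a : 0 < a ->
  (forall s : R, 0 < s -> {for s, continuous f}) ->
  (forall s : R, 0 < s -> 0 <= f s) ->
  (\int[mu]_(s in `[(a / n.+1%:R)%R, +oo[) (f s)%:E)%E @[n --> \oo] -->
  (\int[mu]_(s in `]0%R, +oo[) (f s)%:E)%E.
Proof.
move=> a0 cf f0; rewrite -(bigcup_itv0y a0).
apply: ge0_nondecreasing_set_cvg_integral => //.
- apply/nondecreasing_seqP => n; rewrite subsetEset => s /=.
  rewrite !in_itv/= !andbT; apply: le_trans.
  by rewrite ler_pM2l// lef_pV2 ?posrE// ler_nat.
- move=> n; apply/measurable_EFinP; apply: measurable_funS (continuous_itv0y_measurable cf) => //.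
  move=> s /=; rewrite !in_itv/= !andbT; apply: lt_le_trans.
  by rewrite divr_gt0.
- move=> n s /=; rewrite in_itv/= andbT => h; rewrite lee_fin f0//.
  by apply: lt_le_trans h; rewrite divr_gt0.
Qed.

Lemma cvg_harmonic_at_right : (1 / n.+1%:R : R) @[n --> \oo] --> 0^'+.
Proof.
under eq_fun do rewrite mul1r.
move=> A /= [e /= e0 hA].
have : \forall n \near \oo, `|0 - n.+1%:R^-1| < e.
  by move/cvgrPdist_lt : (@cvg_harmonic R) => /(_ _ e0).
apply: filterS => n hn; apply: hA => //=.
Qed.

Lemma cvg_natS2_pinfty : (n.+2%:R : R) @[n --> \oo] --> +oo.
Proof.
rewrite (_ : (fun n => n.+2%:R) = (fun n => (n + 2)%:R)); last first.
  by apply/funext => n; rewrite addn2.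
by rewrite (cvg_shiftn 2 (fun n => n%:R : R)); exact: cvgr_idn.
Qed.

(** Monotone convergence over [1/(n+1), +oo[: the possibly singular end 0 enters
    only through the limit of F there. *)
Lemma ge0_FTC_itv0y f F (l0 l1 : R) :
  (forall s : R, 0 < s -> {for s, continuous f}) ->
  (forall s : R, 0 < s -> 0 <= f s) ->
  (forall s : R, 0 < s -> is_derive s 1 F (f s)) ->
  F s @[s --> 0^'+] --> l0 -> F s @[s --> +oo] --> l1 ->
  (\int[mu]_(s in `]0%R, +oo[) (f s)%:E)%E = (l1 - l0)%:E.
Proof.
move=> cf f0 dF F0 F1.
have cF (s : R) : 0 < s -> {for s, continuous F}.
  by move=> /dF [dFs _]; exact/differentiable_continuous/derivable1_diffP.
have := ge0_integral_itv0y_cvg (@ltr01 R) cf f0.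
move=> /(cvg_lim (@ereal_hausdorff R)) <-.
apply/cvg_lim; first exact: ereal_hausdorff.
have E n : (\int[mu]_(s in `[(1 / n.+1%:R)%R, +oo[) (f s)%:E)%E =
    (l1 - F (1 / n.+1%:R))%:E.
  have n0 : 0 < 1 / n.+1%:R :> R by rewrite divr_gt0.
  rewrite (@ge0_continuous_FTC2y _ f F (1 / n.+1%:R) l1) ?EFinB//.
  - by move=> s ns; apply/f0/(lt_le_trans n0).
  - apply: continuous_in_subspaceT => s.
    by rewrite inE/= in_itv/= andbT => ns; apply/cf/(lt_le_trans n0).
  - by move=> s ns; have [] := dF s (lt_trans n0 ns).
  - exact/cvg_at_right_filter/cF.
  - move=> s; rewrite in_itv/= andbT => ns.
    by rewrite derive1E; have [_ ->] := dF s (lt_trans n0 ns).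
under eq_cvg do rewrite E.
apply: cvg_EFin; first exact: nearW.
apply: cvgB; first exact: cvg_cst.
exact: (cvg_comp _ _ cvg_harmonic_at_right F0).
Qed.

(** Dominated convergence along the segments [1/(n+1), n+2], which are
    nondegenerate already for n = 0. *)
Lemma integrable_FTC_itv0y f F (l0 l1 : R) :
  (forall s : R, 0 < s -> {for s, continuous f}) ->
  mu.-integrable `]0, +oo[ (EFin \o f) ->
  (forall s : R, 0 < s -> is_derive s 1 F (f s)) ->
  F s @[s --> 0^'+] --> l0 -> F s @[s --> +oo] --> l1 ->
  \int[mu]_(s in `]0, +oo[) f s = l1 - l0.
Proof.
move=> cf fi dF F0 F1.
have cF (s : R) : 0 < s -> {for s, continuous F}.
  by move=> /dF [dFs _]; exact/differentiable_continuous/derivable1_diffP.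
pose D n : set R := `[1 / n.+1%:R, n.+2%:R]%classic.
have mf : measurable_fun (`]0, +oo[ : set R) f.
  exact: continuous_itv0y_measurable.
have D0 n s : D n s -> 0 < s.
  by rewrite /D/= in_itv/= => /andP[+ _]; apply: lt_le_trans; rewrite divr_gt0.
have lD n : 1 / n.+1%:R < n.+2%:R :> R.
  by rewrite ltr_pdivrMr// -natrM ltr1n (leq_trans _ (leq_pmulr _ _)).
have E n : (\int[mu]_(s in `]0%R, +oo[) (((EFin \o f) \_ (D n))%R s))%E =
    (F n.+2%:R - F (1 / n.+1%:R))%:E.
  rewrite -integral_mkcondr (_ : _ `&` D n = D n); last first.
    apply/seteqP; split=> s /= ; first by case.
    by move=> Ds; split => //; rewrite in_itv/= andbT (D0 n).
  rewrite (@continuous_FTC2 _ f F (1 / n.+1%:R) n.+2%:R) ?EFinB//.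
  - apply: continuous_in_subspaceT => s.
    by rewrite inE/= => /D0; exact: cf.
  - split.
    + move=> s; rewrite in_itv/= => /andP[ns _].
      have s0 : 0 < s by apply: lt_trans ns; rewrite divr_gt0.
      by have [] := dF s s0.
    + by apply/cvg_at_right_filter/cF; rewrite divr_gt0.
    + exact/cvg_at_left_filter/cF.
  - move=> s; rewrite in_itv/= => /andP[ns _].
    have s0 : 0 < s by apply: lt_trans ns; rewrite divr_gt0.
    by rewrite derive1E; have [_ ->] := dF s s0.
have [] := @dominated_convergence _ _ R mu `]0, +oo[ _
  (fun n => (EFin \o f) \_ (D n)) (EFin \o f) (fun s => `|(f s)%:E|%E).
- by [].
- move=> n; apply/(measurable_restrict _ _ _).1 => //.
    exact: measurable_itv.
  apply/measurable_EFinP; apply: measurable_funS mf => //.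
- exact/measurable_EFinP.
- apply: aeW => s; rewrite /= in_itv/= andbT => s0.
  apply: cvg_near_cst.
  near=> n.
  rewrite patchE mem_set//= /D/= in_itv/=; apply/andP; split.
    rewrite div1r invf_ple ?posrE// ltW// -natr1 ltr_pwDr//.
    by near: n; exact: nbhs_infty_ger.
  rewrite -addn2 natrD -[leLHS]addr0 lerD//.
  by near: n; exact: nbhs_infty_ger.
- exact: integrable_abse.
- apply: aeW => s n _; rewrite patchE; case: ifPn => //= _.
  by rewrite normr0 lee_fin.
move=> _ _ /(cvg_lim (@ereal_hausdorff R)) H.
rewrite /Rintegral -H -[RHS]/(fine (l1 - l0)%:E); congr fine.
apply/cvg_lim; first exact: ereal_hausdorff.
rewrite /=; under eq_cvg do rewrite E.
apply: cvg_EFin; first exact: nearW.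
apply: cvgB.
  exact: (cvg_comp _ _ cvg_natS2_pinfty F1).
exact: (cvg_comp _ _ cvg_harmonic_at_right F0).
Unshelve. all: by end_near.
Qed.

End improper_integrals.

(** * Gamma integrals *)

Section gamma_integral.
Variable R : realType.
Notation mu := (@lebesgue_measure R).
Implicit Types (p c x s : R).

Definition powexp p c s : R := s `^ p * expR (- c * s).

Lemma powexp_ge0 p c s : 0 <= powexp p c s.
Proof. by rewrite mulr_ge0 ?powR_ge0 ?expR_ge0. Qed.

Lemma is_derive_powexp p c s : 0 < s ->
  is_derive s 1 (powexp p c) (p * powexp (p - 1) c s - c * powexp p c s).
Proof.
move=> s0.
have h := is_derive1_powR p s0.
have he : is_derive s 1 (fun s => expR (- c * s)) (- c * expR (- c * s)).
  have hl : is_derive s 1 (fun s : R => - c * s) (- c).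
    by rewrite -[X in is_derive _ _ _ X]mulr1; exact: is_deriveZ.
  exact: is_derive_eq (@is_derive1_comp _ expR (fun s => - c * s) _ _ _ _ hl)
    (mulrC _ _).
have hM := is_deriveM h he.
apply: (is_derive_eq hM).
by rewrite /powexp /GRing.scale/=; ring.
Qed.

Lemma continuous_powexp p c s : 0 < s -> {for s, continuous (powexp p c)}.
Proof.
move=> /(is_derive_powexp p c) [d _].
exact/differentiable_continuous/derivable1_diffP.
Qed.

(** Raising [u <= expR u] to the power p, with u = c * s / p. *)
Lemma powR_le_expR p c s : 0 < p -> 0 < c -> 0 < s ->
  s `^ p <= (p / c) `^ p * expR (c * s).
Proof.
move=> p0 c0 s0.
have -> : c * s = (c * s / p) * p by rewrite divfK ?gt_eqF.
have {1}-> : s = (p / c) * (c * s / p) by field; rewrite !gt_eqF.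
rewrite powRM ?[in X in _ <= X](expRM _ p); first last.
- by rewrite divr_ge0 ?mulr_ge0// ltW.
- by rewrite divr_ge0// ltW.
rewrite ler_wpM2l ?powR_ge0//; apply: ge0_ler_powR; rewrite ?nnegrE.
- exact: ltW.
- by rewrite divr_ge0// ltW ?mulr_gt0.
- exact: expR_ge0.
- by rewrite (le_trans _ (expR_ge1Dx _))// lerDr.
Qed.

(** For s >= 1 one power of s is kept aside: s^(p+1) <= C e^(cs) gives the bound
    C / s. *)
Lemma powexp_cvg_pinfty p c : 0 < c -> powexp p c s @[s --> +oo] --> 0.
Proof.
move=> c0.
pose q := `|p| + 1.
have q0 : 0 < q by rewrite ltr_wpDl.
pose C := (q / c) `^ q.
apply: (@squeeze_cvgr _ _ _ _ (cst 0) (fun s => C * s^-1)).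
- near=> s; rewrite powexp_ge0/=.
  have s1 : 1 <= s by near: s; exact: nbhs_pinfty_ge.
  have s0 : 0 < s by rewrite (lt_le_trans ltr01).
  rewrite ler_pdivlMr// /powexp mulNr expRN mulrAC ler_pdivrMr ?expR_gt0//.
  apply: le_trans (powR_le_expR q0 c0 s0).
  rewrite -{2}[s]powRr1 ?(ltW s0)// -powRD ?(gt_eqF s0) ?implybT//.
  by apply: ler_powR => //; rewrite lerD2r ler_norm.
- exact: cvg_cst.
- rewrite -(mulr0 C); apply: cvgM; first exact: cvg_cst.
  apply/gtr0_cvgV0; last exact: cvg_id.
  exact: nbhs_pinfty_gt.
Unshelve. all: by end_near. Qed.

Lemma powexp_cvg0 p c : 0 < p -> powexp p c s @[s --> 0^'+] --> 0.
Proof.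
move=> p0; rewrite -[X in _ --> X](mul0r (expR (- c * 0))); apply: cvgM.
  exact: powR_cvg0.
apply: cvg_at_right_filter.
apply: (@continuous_comp _ _ _ (fun s => - c * s) expR).
  exact: mulrl_continuous.
exact: continuous_expR.
Qed.

Notation halfline := (`]0%R, +oo[%classic : set R).

(** The dominating function has finite integral by [ge0_FTC_itv0y], since its
    antiderivative has finite limits. *)
Lemma integrable_le_FTC (f g F : R -> R) (l0 l1 : R) :
  (forall s : R, 0 < s -> {for s, continuous f}) ->
  (forall s : R, 0 < s -> {for s, continuous g}) ->
  (forall s : R, 0 < s -> `|f s| <= g s) ->
  (forall s : R, 0 < s -> is_derive s 1 F (g s)) ->
  F s @[s --> 0^'+] --> l0 -> F s @[s --> +oo] --> l1 ->
  mu.-integrable halfline (EFin \o f).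
Proof.
move=> cf cg fg dF F0 F1.
have g0 s : 0 < s -> 0 <= g s by move=> /fg; apply: le_trans.
apply: (@le_integrable _ _ _ mu _ _ _ (EFin \o g)) => //.
- by apply/measurable_EFinP; exact: continuous_itv0y_measurable.
- move=> s /=; rewrite in_itv/= andbT => s0.
  by rewrite lee_fin (ger0_norm (g0 _ s0)) fg.
- apply/integrableP; split.
    by apply/measurable_EFinP; exact: continuous_itv0y_measurable.
  rewrite (_ : (\int[mu]_(s in _) _)%E = (l1 - l0)%:E) ?ltry//.
  rewrite -(ge0_FTC_itv0y cg g0 dF F0 F1).
  apply: eq_integral => s; rewrite inE/= in_itv/= andbT => s0.
  by rewrite ger0_norm ?g0.
Qed.

(** The dominating function is the derivative of (s^x e^(-cs) - 2 M e^(-cs/2)) / x,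
    where M bounds s^x e^(-cs/2), so that the second term makes up for the negative
    part - c s^x e^(-cs) of the derivative of the first. *)
Lemma integrable_powexp x c : 0 < x -> 0 < c ->
  mu.-integrable halfline (EFin \o powexp (x - 1) c).
Proof.
move=> x0 c0.
pose M := (x / (c / 2)) `^ x.
have M0 : 0 <= M by exact: powR_ge0.
pose g s := x^-1 * ((x * powexp (x - 1) c s - c * powexp x c s) -
  2 * M * (0 * powexp (0 - 1) (c / 2) s - c / 2 * powexp 0 (c / 2) s)).
pose F s := x^-1 * (powexp x c s - 2 * M * powexp 0 (c / 2) s).
have c20 : 0 < c / 2 by rewrite divr_gt0.
apply: (@integrable_le_FTC _ g F (x^-1 * (0 - 2 * M * 1)) (x^-1 * (0 - 2 * M * 0))).
- by move=> s; exact: continuous_powexp.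
- move=> s s0; rewrite /g.
  have cp p q k : {for s, continuous (fun s => k * powexp p q s)}.
    by apply: cvgM; [exact: cvg_cst|exact: continuous_powexp].
  apply: cvgM; first exact: cvg_cst.
  apply: cvgB; first by apply: cvgB; exact: cp.
  by apply: cvgM; [exact: cvg_cst|apply: cvgB; exact: cp].
- move=> s s0; rewrite ger0_norm ?powexp_ge0// /g.
  rewrite mulrC ler_pdivlMr// mulrC mul0r sub0r.
  rewrite -subr_ge0.
  have -> : x * powexp (x - 1) c s - c * powexp x c s -
    2 * M * - (c / 2 * powexp 0 (c / 2) s) - x * powexp (x - 1) c s =
    c * (M * powexp 0 (c / 2) s - powexp x c s) by field.
  rewrite mulr_ge0 ?(ltW c0)// subr_ge0 /powexp powRr0 mul1r.
  have -> : - c * s = c / 2 * s * -1 + - (c / 2) * s by field.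
  rewrite expRD mulrA ler_pM2r ?expR_gt0// mulrN1 expRN ler_pdivrMr ?expR_gt0//.
  exact: powR_le_expR.
- move=> s s0.
  have h1 := is_derive_powexp x c s0.
  have h2 := is_derive_powexp 0 (c / 2) s0.
  exact: is_deriveZ (is_deriveB h1 (is_deriveZ (2 * M) h2)).
- apply: cvgM; first exact: cvg_cst.
  apply: cvgB; first exact: powexp_cvg0.
  apply: cvgM; first exact: cvg_cst.
  rewrite (_ : powexp 0 (c / 2) = fun s => expR (- (c / 2) * s)); last first.
    by apply/funext => s; rewrite /powexp powRr0 mul1r.
  rewrite -[X in _ --> X](@expR0 R) -[in X in _ --> X](mulr0 (- (c / 2))).
  apply: cvg_at_right_filter.
  apply: (@continuous_comp _ _ _ (fun s => - (c / 2) * s) expR).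
    exact: mulrl_continuous.
  exact: continuous_expR.
- apply: cvgM; first exact: cvg_cst.
  apply: cvgB; first exact: powexp_cvg_pinfty.
  by apply: cvgM; [exact: cvg_cst|exact: powexp_cvg_pinfty].
Qed.

(** The Laplace form of the Gamma integral, c^(-x) Gamma x by [gammac_scale]. *)
Definition gammac x c : R := \int[mu]_(s in `]0, +oo[) powexp (x - 1) c s.

(** Integrate the derivative of s^x e^(-cs), which vanishes at both ends. *)
Lemma gammacS x c : 0 < x -> 0 < c -> c * gammac (x + 1) c = x * gammac x c.
Proof.
move=> x0 c0; apply/eqP; rewrite eq_sym -subr_eq0; apply/eqP.
have i0 := integrable_powexp x0 c0.
have i1 : mu.-integrable halfline (EFin \o powexp x c).
  by rewrite -[x in powexp x](addrK 1); apply: integrable_powexp => //; exact: addr_gt0.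
rewrite /gammac addrK -!RintegralZl// -RintegralB//; last 2 first.
  exact: (integrableZl _ x i0).
  exact: (integrableZl _ c i1).
rewrite -[RHS](subr0 0); apply: (integrable_FTC_itv0y (F := powexp x c)).
- move=> s s0.
  by apply: cvgB; (apply: cvgM; [exact: cvg_cst|exact: continuous_powexp]).
- exact: (integrableB _ (integrableZl _ x i0) (integrableZl _ c i1)).
- by move=> s s0; exact: is_derive_powexp.
- exact: powexp_cvg0.
- exact: powexp_cvg_pinfty.
Qed.

End gamma_integral.

(** * The Gamma function *)

Section gamma_function.
Variable R : realType.
Notation mu := (@lebesgue_measure R).
Notation halfline := (`]0%R, +oo[%classic : set R).
Implicit Types (p c x s z : R).

(** Substitution s -> c s on [1/(n+1), +oo[, which becomes [c/(n+1), +oo[; both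
    families exhaust the half-line. *)
Lemma gammac_scale x c : 0 < x -> 0 < c -> gammac x c = c `^ (- x) * gammac x 1.
Proof.
move=> x0 c0.
have cG s : 0 < s -> {for s, continuous (powexp (x - 1) 1)}.
  by move=> s0; exact: continuous_powexp.
pose h s := c `^ x * powexp (x - 1) c s.
have ch s : 0 < s -> {for s, continuous h}.
  by move=> s0; apply: cvgM; [exact: cvg_cst|exact: continuous_powexp].
have h0 s : 0 < s -> 0 <= h s by move=> _; rewrite mulr_ge0 ?powR_ge0 ?powexp_ge0.
have G0 s : 0 < s -> 0 <= powexp (x - 1) 1 s by move=> _; exact: powexp_ge0.
have dl s : is_derive s 1 (fun s : R => c * s) c.
  by rewrite -[X in is_derive _ _ _ X]mulr1; exact: is_deriveZ.
have dlE : derive1 (fun s : R => c * s) = cst c.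
  by apply/funext => s; rewrite derive1E; have [_ ->] := dl s.
have hE s : 0 < s -> (powexp (x - 1) 1 \o (fun s : R => c * s)) s * c = h s.
  move=> s0; rewrite /h /powexp /= mulN1r mulNr powRM ?ltW//.
  rewrite -(mulr_powRB1 (ltW c0) x0); ring.
have E n : (\int[mu]_(s in `[(c / n.+1%:R)%R, +oo[) (powexp (x - 1) 1 s)%:E)%E =
           (\int[mu]_(s in `[(1 / n.+1%:R)%R, +oo[) (h s)%:E)%E.
  have n0 : 0 < 1 / n.+1%:R :> R by rewrite divr_gt0.
  rewrite [c / _](_ : _ = c * (1 / n.+1%:R)); last by rewrite mul1r.
  rewrite (@increasing_ge0_integration_by_substitutiony _ (fun s => c * s)).
  - apply: eq_integral => s; rewrite inE/= in_itv/= andbT => ns.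
    by rewrite dlE -hE ?(lt_le_trans n0).
  - by move=> s t _ _; rewrite ltr_pM2l.
  - by move=> s _; rewrite dlE; exact: cvg_cst.
  - by rewrite dlE; exact: is_cvg_cst.
  - by rewrite dlE; exact: is_cvg_cst.
  - split; first by move=> s _; have [] := dl s.
    exact/cvg_at_right_filter/mulrl_continuous.
  - exact: gt0_cvgMry.
  - apply: continuous_in_subspaceT => s.
    rewrite inE/= in_itv/= andbT => ns; apply/cG/(lt_le_trans _ ns).
    by rewrite mulr_gt0.
  - by move=> s _; exact: powexp_ge0.
have H1 := ge0_integral_itv0y_cvg c0 cG G0.
have H2 := ge0_integral_itv0y_cvg (@ltr01 R) ch h0.
have HE : (\int[mu]_(s in `]0%R, +oo[) (powexp (x - 1) 1 s)%:E)%E =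
          (\int[mu]_(s in `]0%R, +oo[) (h s)%:E)%E.
  move: H1 H2 => /(cvg_lim (@ereal_hausdorff R)) <-.
  move=> /(cvg_lim (@ereal_hausdorff R)) <-.
  by rewrite (funext E).
have -> : gammac x 1 = \int[mu]_(s in `]0, +oo[) h s.
  by rewrite /gammac /Rintegral HE.
rewrite RintegralZl//; last exact: integrable_powexp.
by rewrite mulrA powRN mulVf ?mul1r// gt_eqF// powR_gt0.
Qed.

(** On [1, 2] the integrand is at least the constant m. *)
Lemma gammac_gt0 x c : 0 < x -> 0 < c -> 0 < gammac x c.
Proof.
move=> x0 c0.
have i0 := integrable_powexp x0 c0.
pose m := expR (- (`|x - 1| * ln 2) - c * 2).
have m0 : 0 < m by exact: expR_gt0.
apply: (lt_le_trans m0); rewrite -lee_fin /gammac fineK; last first.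
  exact: integrable_fin_num.
have sub : (`[1%R, 2%R]%classic : set R) `<=` halfline.
  by move=> s /=; rewrite !in_itv/= andbT => /andP[s1 _]; exact: lt_le_trans s1.
apply: (@le_trans _ _ (\int[mu]_(s in `[1%R, 2%R]) (powexp (x - 1) c s)%:E)%E); last first.
  apply: ge0_subset_integral => //.
  - by have := measurable_int _ i0.
  - by move=> s _; rewrite lee_fin powexp_ge0.
apply: (@le_trans _ _ (\int[mu]_(s in `[1%R, 2%R]) m%:E)%E).
  rewrite integral_cst//= lebesgue_measure_itv/= lte_fin ltr1n/=.
  by rewrite -EFinD -EFinM lee_fin -addrA addrN addr0 mulr1.
apply: ge0_le_integral => //.
- by move=> s _; rewrite lee_fin ltW.
- by apply: measurable_funS (measurable_int _ i0).
- move=> s; rewrite /= in_itv/= => /andP[s1 s2].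
  have s0 : 0 < s by rewrite (lt_le_trans ltr01).
  rewrite lee_fin /powexp /powR gt_eqF// -expRD ler_expR lerD//.
    rewrite lerNl -mulNr.
    apply: (@le_trans _ _ (`|x - 1| * ln s)).
      by rewrite ler_wpM2r ?ln_ge0// -normrN ler_norm.
    by rewrite ler_wpM2l// ler_ln ?posrE.
  by rewrite mulNr lerN2 ler_pM2l.
Qed.

Lemma euler_gammaE x : euler_gamma x = gammac x 1.
Proof.
by apply: eq_Rintegral => s _; rewrite /powexp mulN1r.
Qed.

Lemma Gamma_gt0E x : 0 < x -> Gamma x = gammac x 1.
Proof.
by move=> x0; rewrite /Gamma /gamma_shift x0 addr0 big_ord0 divr1 euler_gammaE.
Qed.

Lemma Gamma_gt0 x : 0 < x -> 0 < Gamma x.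
Proof. by move=> x0; rewrite Gamma_gt0E// gammac_gt0. Qed.

Lemma GammaS x : 0 < x -> Gamma (x + 1) = x * Gamma x.
Proof.
by move=> x0; rewrite !Gamma_gt0E ?addr_gt0// -gammacS// mul1r.
Qed.

(** In this form the functional equation also holds at the poles, where the
    convention 1 / Gamma = 0 makes both sides vanish. *)
Lemma inv_Gamma z : (Gamma z)^-1 = z * (Gamma (z + 1))^-1.
Proof.
have [z0|z0] := ltP 0 z.
  rewrite GammaS//; move: (Gamma z) => g.
  by rewrite invfM mulrA divff ?mul1r// gt_eqF.
pose n := Num.truncn (- z).
have nz : 0 <= - z by rewrite oppr_ge0.
have s1 : gamma_shift (z + 1) = n.
  rewrite /gamma_shift; case: ifPn => z1.
    by apply/esym/eqP; rewrite truncn_eq//; lra.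
  rewrite -leNgt in z1.
  apply/esym/truncn_def; rewrite -!natr1.
  have : 0 <= - (z + 1) by lra.
  move=> /truncn_itv /andP[]; rewrite -natr1 => h1 h2; apply/andP; split; lra.
rewrite /Gamma s1 /gamma_shift ltNge z0/= -/n big_ord_recl addr0.
have -> : z + n.+1%:R = z + 1 + n%:R by rewrite -natr1 addrAC addrA.
rewrite !invf_div mulrA; congr (_ / _); congr (_ * _).
by apply: eq_bigr => i _; rewrite /= /bump/= -natr1 addrAC addrA.
Qed.

Definition falling m (y : R) := \prod_(i < m) (y - i%:R).

(** Each lowering of the argument of 1 / Gamma by 1 brings out one factor, also
    across the poles by [inv_Gamma]. *)
Lemma Gamma_ratio y m : 0 <= y -> Gamma (y + 1) / Gamma (y + 1 - m%:R) = falling m y.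
Proof.
move=> y0; elim: m => [|m IH].
  by rewrite mulr0n subr0 /falling big_ord0 divff// gt_eqF// Gamma_gt0// ltr_wpDl.
rewrite inv_Gamma /falling big_ord_recr/= -/(falling m y) -IH.
have -> : y + 1 - m.+1%:R + 1 = y + 1 - m%:R by rewrite -natr1; ring.
have -> : y + 1 - m.+1%:R = y - m%:R by rewrite -natr1; ring.
by rewrite mulrCA mulrC.
Qed.

End gamma_function.

(** * The jump rates *)

Section jump_rates.
Variables (R : realType) (lambda theta alpha : R).
Hypotheses (l0 : 0 < lambda) (t0 : 0 < theta) (a0 : 0 < alpha) (a1 : alpha < 1).
Notation mu := (@lebesgue_measure R).
Notation halfline := (`]0%R, +oo[%classic : set R).
Implicit Types (s : R) (k m : nat).

(** The coefficient of u^k in theta^alpha - (theta + lambda - lambda u)^alpha. *)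
Definition rate k : R :=
  (k == 0%N)%:R * theta `^ alpha -
  (theta + lambda) `^ alpha *
    ((- lambda / (theta + lambda)) ^+ k / k`!%:R * falling k alpha).

(** From k to k + 1 the functional equation multiplies the left-hand side by
    k - alpha, and the falling factorial gains the opposite factor alpha - k. *)
Lemma gammac_falling k : (0 < k)%N ->
  alpha * gammac (k%:R - alpha) 1 = - (-1) ^+ k * falling k alpha * Gamma (1 - alpha).
Proof.
case: k => // k _; elim: k => [|k IH].
  rewrite /falling big_ord1/= Gamma_gt0E ?subr_gt0//; ring.
have k0 : 0 < k.+1%:R - alpha.
  by rewrite subr_gt0 (lt_le_trans a1)// ler1n.
rewrite -natr1 addrAC -[gammac _ _]mul1r gammacS// mulrCA IH.
rewrite [falling k.+2 _]/falling big_ord_recr/= -/(falling k.+1 alpha) !exprS; ring.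
Qed.

(** The two exponentials combine into e^(-(theta + lambda) s), which leaves a Gamma
    integral of parameter k - alpha > 0. *)
Lemma jump_rateE k : (0 < k)%N ->
  lambda ^+ k / k`!%:R *
    tempered_integral alpha theta (fun s => expR (- lambda * s) * s ^+ k) = rate k.
Proof.
move=> k0.
have c0 : 0 < theta + lambda by exact: addr_gt0.
have x0 : 0 < k%:R - alpha.
  by rewrite subr_gt0 (lt_le_trans a1)// ler1n.
have G0 : 0 < Gamma (1 - alpha) by rewrite Gamma_gt0// subr_gt0.
have -> : tempered_integral alpha theta (fun s => expR (- lambda * s) * s ^+ k)
   = (alpha / Gamma (1 - alpha)) * gammac (k%:R - alpha) (theta + lambda).
  rewrite -RintegralZl//; last exact: integrable_powexp.
  apply: eq_Rintegral => s; rewrite inE/= in_itv/= andbT => s0.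
  rewrite /tempered_density /powexp.
  have -> : k%:R - alpha - 1 = k%:R + (- alpha - 1) by rewrite addrA.
  rewrite [s `^ (k%:R + _)]powRD ?(gt_eqF s0) ?implybT// powR_mulrn ?ltW//.
  have -> : - (theta + lambda) * s = - theta * s + - lambda * s by ring.
  rewrite expRD; ring.
rewrite gammac_scale//.
have -> : alpha / Gamma (1 - alpha) * ((theta + lambda) `^ (- (k%:R - alpha)) *
    gammac (k%:R - alpha) 1) = (alpha * gammac (k%:R - alpha) 1) *
    (theta + lambda) `^ (- (k%:R - alpha)) / Gamma (1 - alpha) by ring.
rewrite gammac_falling// opprB powRB ?(gt_eqF c0) ?implybT// powR_mulrn ?(ltW c0)//.
rewrite /rate (gtn_eqF k0) mul0r sub0r.
have -> : - lambda / (theta + lambda) = (-1) * lambda / (theta + lambda) by ring.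
rewrite !exprMn exprVn; field.
by rewrite pnatr_eq0 -lt0n fact_gt0 expf_neq0 ?gt_eqF.
Qed.

Lemma powexpS p c s : 0 < s -> s * powexp p c s = powexp (p + 1) c s.
Proof.
move=> s0; rewrite /powexp mulrA powRD ?(gt_eqF s0) ?implybT//.
by rewrite powRr1 ?(ltW s0)// [s * _]mulrC.
Qed.

Lemma powexpD p s :
  powexp p (theta + lambda) s = expR (- lambda * s) * powexp p theta s.
Proof.
rewrite /powexp mulrCA -expRD; congr (_ * expR _); ring.
Qed.

Lemma onem_expR_itv s : 0 < s -> 0 <= 1 - expR (- lambda * s) <= lambda * s.
Proof.
move=> s0; rewrite subr_ge0 expR_le1 mulNr oppr_le0 mulr_ge0 ?(ltW l0) ?(ltW s0)//=.
have := expR_ge1Dx (- (lambda * s)); lra.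
Qed.

Lemma integrable_halflineZl (r : R) (f : R -> R) :
  mu.-integrable halfline (EFin \o f) ->
  mu.-integrable halfline (EFin \o (fun s => r * f s)).
Proof. by move=> fi; exact: (integrableZl _ r fi). Qed.

Lemma continuous_nojump p s : 0 < s ->
  {for s, continuous (fun s => (1 - expR (- lambda * s)) * powexp p theta s)}.
Proof.
move=> s0.
have -> : (fun s => (1 - expR (- lambda * s)) * powexp p theta s) =
          (fun s => powexp p theta s - powexp p (theta + lambda) s).
  by apply/funext => u; rewrite mulrBl mul1r -powexpD.
by apply: cvgB; exact: continuous_powexp.
Qed.

Lemma integrable_nojump : mu.-integrable halfline
  (EFin \o (fun s => (1 - expR (- lambda * s)) * powexp (- alpha - 1) theta s)).
Proof.
have b0 : 0 < 1 - alpha by rewrite subr_gt0.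
have i1 := integrable_halflineZl lambda (integrable_powexp b0 t0).
apply: (le_integrable _ _ _ i1) => //.
- apply/measurable_EFinP; apply: continuous_itv0y_measurable => s s0.
  exact: continuous_nojump.
- move=> s; rewrite /= in_itv/= andbT => s0.
  have /andP[h1 h2] := onem_expR_itv s0.
  rewrite lee_fin /= (ger0_norm (mulr_ge0 h1 (powexp_ge0 _ _ _))).
  rewrite (ger0_norm (mulr_ge0 (ltW l0) (powexp_ge0 _ _ _))).
  rewrite [1 - alpha - 1](_ : _ = - alpha - 1 + 1); last by ring.
  by rewrite -powexpS// [leRHS]mulrA ler_wpM2r ?powexp_ge0.
Qed.

(** Integration by parts: s^(-alpha) (e^(-(theta+lambda)s) - e^(-theta s))
    vanishes at both ends of the half-line. *)
Lemma nojump_rateE :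
  tempered_integral alpha theta (fun s => 1 - expR (- lambda * s)) = - rate 0.
Proof.
have c0 : 0 < theta + lambda by exact: addr_gt0.
have b0 : 0 < 1 - alpha by rewrite subr_gt0.
have G0 : 0 < Gamma (1 - alpha) by exact: Gamma_gt0.
have bE : - alpha = 1 - alpha - 1 by ring.
have ig := integrable_nojump.
pose g s := (1 - expR (- lambda * s)) * powexp (- alpha - 1) theta s.
have -> : tempered_integral alpha theta (fun s => 1 - expR (- lambda * s)) =
    (\int[mu]_(s in `]0, +oo[) (alpha * g s)) / Gamma (1 - alpha).
  rewrite RintegralZl// mulrAC -RintegralZl//.
  apply: eq_Rintegral => s _; rewrite /tempered_density /g /powexp; ring.
have ic : mu.-integrable halfline (EFin \o powexp (- alpha) (theta + lambda)).
  by rewrite bE; exact: integrable_powexp.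
have it : mu.-integrable halfline (EFin \o powexp (- alpha) theta).
  by rewrite bE; exact: integrable_powexp.
have iga := integrable_halflineZl alpha ig.
have icc := integrable_halflineZl (theta + lambda) ic.
have itt := integrable_halflineZl theta it.
pose f s := alpha * g s - ((theta + lambda) * powexp (- alpha) (theta + lambda) s
              - theta * powexp (- alpha) theta s).
pose F s := powexp (- alpha) (theta + lambda) s - powexp (- alpha) theta s.
have : \int[mu]_(s in `]0, +oo[) f s = 0 - 0.
  apply: (integrable_FTC_itv0y (F := F)).
  - move=> s s0.
    have cg : {for s, continuous g} by exact: continuous_nojump.
    apply: cvgB; first by apply: cvgM; [exact: cvg_cst|exact: cg].
    by apply: cvgB; (apply: cvgM; [exact: cvg_cst|exact: continuous_powexp]).
  - exact: (integrableB _ iga (integrableB _ icc itt)).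
  - move=> s s0.
    have h := is_deriveB (is_derive_powexp (- alpha) (theta + lambda) s0)
                         (is_derive_powexp (- alpha) theta s0).
    by apply: (is_derive_eq h); rewrite /f /g !powexpD; ring.
  - apply: (@squeeze_cvgr _ _ _ _ (fun s => - (lambda * powexp (1 - alpha) theta s)) (cst 0)).
    + near=> s.
      have s0 : 0 < s by near: s; exact: nbhs_right_gt.
      have /andP[h1 h2] := onem_expR_itv s0.
      have -> : F s = - ((1 - expR (- lambda * s)) * powexp (- alpha) theta s).
        by rewrite /F powexpD; ring.
      rewrite lerN2 oppr_le0 mulr_ge0 ?powexp_ge0// andbT.
      by rewrite [1 - alpha]addrC -powexpS// [leRHS]mulrA ler_wpM2r ?powexp_ge0.
    + rewrite -[X in _ --> X]oppr0 -[X in _ --> - X](mulr0 lambda).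
      apply: cvgN; apply: cvgM; first exact: cvg_cst.
      exact: powexp_cvg0.
    + exact: cvg_cst.
  - rewrite -[X in _ --> X](subr0 0).
    by apply: cvgB; exact: powexp_cvg_pinfty.
rewrite subrr RintegralB//; last exact: (integrableB _ icc itt).
rewrite RintegralB// !RintegralZl// => /eqP.
rewrite subr_eq0 => /eqP ->.
have gE x : \int[mu]_(s in `]0, +oo[) powexp (- alpha) x s = gammac (1 - alpha) x.
  by rewrite /gammac -bE.
have cE x : 0 < x -> x * gammac (1 - alpha) x = x `^ alpha * Gamma (1 - alpha).
  move=> x0; rewrite gammac_scale// Gamma_gt0E// opprB mulrA.
  by rewrite mulr_powRB1// ltW.
rewrite !gE !cE// -mulrBl mulfK ?gt_eqF//.
by rewrite /rate /falling big_ord0 !expr0 fact0 eqxx mul1r invr1 !mulr1 mul1r opprB.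
Unshelve. all: by end_near.
Qed.

End jump_rates.

(** * Generalized binomial coefficients and exponential generating series *)

Section binomials.
Variable R : realType.
Implicit Types (x y : R) (m k j : nat).

Definition gbin m x : R := falling m x / m`!%:R.

Lemma gbin0 x : gbin 0 x = 1.
Proof. by rewrite /gbin /falling big_ord0 fact0 divr1. Qed.

Lemma gbin_at0 m : gbin m 0 = (m == 0%N)%:R.
Proof.
case: m => [|m]; first by rewrite gbin0.
by rewrite /gbin /falling big_ord_recl subr0 !mul0r.
Qed.

Lemma gbinS m x : m.+1%:R * gbin m.+1 x = (x - m%:R) * gbin m x.
Proof.
rewrite /gbin [falling m.+1 x]/falling big_ord_recr/= -/(falling m x) factS natrM.
by field; rewrite pnatr_eq0 -lt0n fact_gt0 addrC natr1 pnatr_eq0.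
Qed.

(** Chu-Vandermonde. Multiply by m+1 and split x + y - m as
    (x - j) + (y - (m - j)) in the j-th term. *)
Lemma gbinD m x y :
  gbin m (x + y) = \sum_(j < m.+1) gbin j x * gbin (m - j) y.
Proof.
elim: m => [|m IH]; first by rewrite big_ord1 !gbin0 mulr1.
have m0 : m.+1%:R != 0 :> R by rewrite pnatr_eq0.
apply: (mulfI m0); rewrite gbinS IH mulr_sumr.
pose u j := j%:R * gbin j x * gbin (m.+1 - j) y.
pose v j := (m.+1 - j)%:R * gbin j x * gbin (m.+1 - j) y.
rewrite mulr_sumr [RHS](_ : _ = \sum_(j < m.+2) u j + \sum_(j < m.+2) v j); last first.
  rewrite -big_split/=; apply: eq_bigr => j _.
  rewrite /u /v -mulrDl -mulrDl -natrD subnKC ?mulrA//.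
  by rewrite -ltnS.
rewrite [\sum_(j < m.+2) u j]big_ord_recl [\sum_(j < m.+2) v j]big_ord_recr/=.
rewrite /u /v subnn !mulr0n !mul0r add0r addr0 -big_split/=; apply: eq_bigr => j _.
rewrite /bump/= add1n subSS.
have jm : (j <= m)%N by rewrite -ltnS.
have -> : (x + y - m%:R) * (gbin j x * gbin (m - j) y) =
    ((x - j%:R) * gbin j x) * gbin (m - j) y +
    gbin j x * ((y - (m - j)%:R) * gbin (m - j) y) by rewrite natrB//; ring.
by rewrite -!gbinS subSn//; ring.
Qed.

(** Factor by factor: |a k - i| <= k + i <= 2^k (i + 1), and the product of the
    i + 1 is m!. *)
Lemma normr_gbin_le a m k : 0 <= a <= 1 ->
  `|gbin m (a * k%:R)| <= (2 ^+ m) ^+ k.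
Proof.
move=> /andP[a0 a1]; rewrite /gbin normrM normfV (ger0_norm (ler0n _ _)).
rewrite ler_pdivrMr ?ltr0n ?fact_gt0//.
rewrite /falling normr_prod exprAC; elim: m => [|m IH]; first by rewrite big_ord0 fact0 expr0 mul1r.
rewrite big_ord_recr/= exprS factS natrM.
rewrite mulrACA [leLHS]mulrC ler_pM//; first exact: prodr_ge0.
rewrite (@le_trans _ _ (k%:R + m%:R))//.
  rewrite (le_trans (ler_normB _ _))// !ger0_norm ?mulr_ge0// lerD2r.
  by rewrite -[leRHS]mul1r ler_wpM2r.
rewrite -natrD -natrX -natrM ler_nat.
apply: (@leq_trans (k.+1 * m.+1)); first by rewrite mulSn mulnS; lia.
by rewrite leq_mul2r ltn_expl// orbT.
Qed.

End binomials.

Section exponential_generating_series.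
Variable R : realType.
Implicit Types (a b : nat -> R) (z : R).

(** Enough for an exponential generating series to converge everywhere, and
    stable under the shift of the sequence. *)
Definition geometric_bound a := exists B C : R, forall k, `|a k| <= C * B ^+ k.

Definition egs a z : R := limn (pseries (fun k => a k / k`!%:R) z).

Lemma egs_cvg a z : geometric_bound a -> pseries (fun k => a k / k`!%:R) z @ \oo --> egs a z.
Proof.
move=> [B [C aB]].
have C0 : 0 <= C by have := aB 0%N; rewrite expr0 mulr1; apply: le_trans.
suff : cvgn (pseries (fun k => a k / k`!%:R) z) by [].
apply: normed_cvg.
apply: (@series_le_cvg _ _ (fun k => C * exp_coeff `|B * z| k)).
- by move=> k; rewrite normr_ge0.
- by move=> k; rewrite mulr_ge0// exp_coeff_ge0.
- move=> k; rewrite /exp_coeff/= !normrM normfV (ger0_norm (ler0n _ _)).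
  rewrite normrX.
  rewrite [leRHS](_ : _ = C * `|B| ^+ k / k`!%:R * `|z| ^+ k); last by rewrite exprMn; ring.
  rewrite ler_wpM2r ?exprn_ge0// ler_wpM2r ?invr_ge0//.
  by rewrite (le_trans (aB k))// ler_wpM2l// -normrX ler_norm.
- exact: is_cvg_seriesZ (is_cvg_series_exp_coeff `|B * z|).
Qed.

Lemma geometric_boundS a : geometric_bound a -> geometric_bound (a \o S).
Proof.
move=> [B [C h]]; exists B, (C * B) => k /=.
by rewrite -mulrA -exprS.
Qed.

(** Termwise differentiation shifts the sequence. *)
Lemma is_derive_egs a z : geometric_bound a -> is_derive z 1 (egs a) (egs (a \o S) z).
Proof.
have dE b : pseries_diffs (fun k => b k / k`!%:R) = fun k => (b \o S) k / k`!%:R.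
  apply/funext => k; rewrite /pseries_diffs /= factS natrM.
  by field; rewrite pnatr_eq0 -lt0n fact_gt0 addrC natr1 pnatr_eq0.
move=> ha; have hb := geometric_boundS ha; have hc := geometric_boundS hb.
have cK b K : geometric_bound b -> cvgn (pseries (fun k => b k / k`!%:R) K).
  by move=> /(egs_cvg (z := K)) h; apply/cvg_ex; exists (egs b K).
rewrite {2}/egs -dE.
apply: (@pseries_snd_diffs _ _ (`|z| + 1)); rewrite ?dE; try exact: cK.
by rewrite (ger0_norm (addr_ge0 _ _))// ltrDl.
Qed.

Lemma egs0 a : egs a 0 = a 0%N.
Proof.
rewrite /egs; apply/cvg_lim => //; rewrite -(cvg_shiftn 1).
rewrite (_ : (fun _ => _) = cst (a 0%N)); first exact: cvg_cst.
apply/funext => n; rewrite addn1 /pseries /series/= big_nat_recl// fact0 divr1 mulr1.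
by rewrite big1 ?addr0// => i _; rewrite expr0n mulr0.
Qed.

Lemma egs_sum (I : Type) (r : seq I) (c : I -> R) (a : I -> nat -> R) z :
  (forall i, geometric_bound (a i)) ->
  egs (fun k => \sum_(i <- r) c i * a i k) z = \sum_(i <- r) c i * egs (a i) z.
Proof.
move=> ha; apply/cvg_lim => //.
have -> : pseries (fun k => (\sum_(i <- r) c i * a i k) / k`!%:R) z =
   (fun n => \sum_(i <- r) c i * pseries (fun k => a i k / k`!%:R) z n).
  apply/funext => n; rewrite /pseries /series/= [RHS](eq_bigr (fun i =>
    \sum_(0 <= k < n) c i * (a i k / k`!%:R * z ^+ k))); last by move=> i _; rewrite mulr_sumr.
  rewrite exchange_big/=; apply: eq_bigr => k _.
  by rewrite !mulr_suml; apply: eq_bigr => i _; rewrite !mulrA.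
elim: r => [|i r IH].
  under eq_fun do rewrite big_nil. rewrite big_nil. exact: cvg_cst.
rewrite big_cons; under eq_fun do rewrite big_cons.
by apply: cvgD IH; apply: cvgM; [exact: cvg_cst|exact: egs_cvg].
Qed.

End exponential_generating_series.

(** * The candidate laws *)

Section candidate.
Variables (R : realType) (lambda theta alpha : R).
Hypotheses (a0 : 0 < alpha) (a1 : alpha < 1).
Implicit Types (t : R) (m k j : nat).

(** Formally, the coefficient of u^m in
    exp (t (theta^alpha - (theta + lambda - lambda u)^alpha)):
    expand exp (- t (theta + lambda - lambda u)^alpha) in powers of its argument,
    and then each (theta + lambda - lambda u)^(alpha k) by Newton's series. *)
Definition tempered_pmf m t : R :=
  (- lambda / (theta + lambda)) ^+ m * expR (theta `^ alpha * t) *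
  egs (fun k => gbin m (alpha * k%:R)) (- t * (theta + lambda) `^ alpha).

Lemma geometric_bound_gbin m : geometric_bound (fun k => gbin m (alpha * k%:R)).
Proof.
by exists (2 ^+ m), 1 => k; rewrite mul1r normr_gbin_le// (ltW a0) (ltW a1).
Qed.

Lemma egs_gbinS m z :
  egs ((fun k => gbin m (alpha * k%:R)) \o S) z =
  \sum_(j < m.+1) gbin j alpha * egs (fun k => gbin (m - j) (alpha * k%:R)) z.
Proof.
rewrite -egs_sum; last by move=> j; exact: geometric_bound_gbin.
congr (egs _ z); apply/funext => k /=.
by rewrite -natr1 mulrDr mulr1 addrC gbinD.
Qed.

Lemma tempered_pmf_at0 m : tempered_pmf m 0 = (m == 0%N)%:R.
Proof.
rewrite /tempered_pmf oppr0 mul0r egs0 !mulr0 gbin_at0.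
by case: m => [|m]; rewrite ?mulr0// expR0 !mulr1.
Qed.

(** The exponential prefactor contributes theta^alpha, that is the first half of
    [rate] 0; the series contributes all the other terms through [egs_gbinS]. *)
Lemma is_derive_tempered_pmf m t :
  is_derive t 1 (tempered_pmf m) (\sum_(j < m.+1) rate lambda theta alpha j * tempered_pmf (m - j) t).
Proof.
pose c := (theta + lambda) `^ alpha; pose q := - lambda / (theta + lambda).
have lin (b : R) : is_derive t 1 (fun t => b * t) b.
  by rewrite -[X in is_derive _ _ _ X]mulr1; exact: is_deriveZ.
have h1 : is_derive t 1 (fun t => expR (theta `^ alpha * t))
    (expR (theta `^ alpha * t) * theta `^ alpha).
  exact: (@is_derive1_comp _ expR (fun t => theta `^ alpha * t)).
have h2 : is_derive t 1 (fun t => egs (fun k => gbin m (alpha * k%:R)) (- t * c))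
    (egs ((fun k => gbin m (alpha * k%:R)) \o S) (- t * c) * (- c)).
  have hg := is_derive_egs (- t * c) (geometric_bound_gbin m).
  have hl : is_derive t 1 (fun t => - t * c) (- c).
    rewrite (_ : (fun _ => _) = fun t => - c * t); first exact: lin.
    by apply/funext => u; rewrite mulNr mulrC mulNr.
  exact: (@is_derive1_comp _ _ (fun t => - t * c) _ _ _ hg hl).
have h := is_deriveZ (q ^+ m) (is_deriveM h1 h2).
have -> : tempered_pmf m = q ^+ m \*: ((fun t => expR (theta `^ alpha * t)) *
   (fun t => egs (fun k => gbin m (alpha * k%:R)) (- t * c))).
  by apply/funext => u; rewrite /tempered_pmf /= -mulrA.
apply: (is_derive_eq h).
rewrite egs_gbinS /GRing.scale/=.
rewrite [RHS](eq_bigr (fun j : 'I_m.+1 =>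
  (j == ord0)%:R * theta `^ alpha * tempered_pmf m t +
  - c * q ^+ m * expR (theta `^ alpha * t) *
   (gbin j alpha * egs (fun k => gbin (m - j) (alpha * k%:R)) (- t * c)))).
  rewrite big_split/= -mulr_sumr.
  rewrite [X in _ = X + _](_ : _ = theta `^ alpha * tempered_pmf m t); last first.
    rewrite (bigD1 ord0)// eqxx mul1r big1 /= ?addr0// => i /negPf ->.
    by rewrite !mul0r.
  rewrite /tempered_pmf -/c -/q; ring.
move=> j _; have jm : (j <= m)%N by rewrite -ltnS.
rewrite /rate -/c -/q mulrBl; congr (_ + _).
  have [->|] := eqVneq j ord0; first by rewrite subn0 eqxx.
  by move=> /negPf j0; rewrite (_ : (j == 0%N :> nat) = false) ?mul0r.
have -> : q ^+ m = q ^+ (m - j) * q ^+ j by rewrite -exprD subnK.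
rewrite /tempered_pmf -/c -/q [gbin j _]/gbin; ring.
Qed.

End candidate.

(** * Uniqueness for triangular linear systems *)

Section triangular_system.
Variable R : realType.
Implicit Types (t : R) (m j : nat).

Lemma derive0_cst (f : R -> R) (l : R) :
  (forall t, 0 < t -> is_derive t 1 f 0) -> f t @[t --> 0^'+] --> l ->
  forall t, 0 < t -> f t = l.
Proof.
move=> df fl t t0.
have E s : 0 < s -> s < t -> f s = f t.
  move=> s0 st.
  have [x||u _] := @MVT _ f (fun=> 0) s t st.
  - by rewrite in_itv/= => /andP[sx _]; apply/df/(lt_trans s0).
  - apply: derivable_within_continuous => x; rewrite in_itv/= => /andP[sx _].
    by have [] := df x (lt_le_trans s0 sx).
  - by rewrite mul0r => /eqP; rewrite subr_eq0 => /eqP ->.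
apply/(cvg_unique _ _ fl) => //.
apply: cvg_near_cst; near=> s; apply: E.
  by near: s; exact: nbhs_right_gt.
by near: s; exact: nbhs_right_lt.
Unshelve. all: by end_near. Qed.

(** By induction on m: once the lower components agree, the difference y of the
    m-th ones satisfies y' = r 0 * y, so that D = e^(- r 0 t) y is constant, hence
    equal to its limit 0 at 0. *)
Lemma triangular_ode_unique (r l : nat -> R) (f g : nat -> R -> R) :
  (forall m t, 0 < t -> is_derive t 1 (f m) (\sum_(j < m.+1) r j * f (m - j)%N t)) ->
  (forall m t, 0 < t -> is_derive t 1 (g m) (\sum_(j < m.+1) r j * g (m - j)%N t)) ->
  (forall m, f m t @[t --> 0^'+] --> l m) ->
  (forall m, g m t @[t --> 0^'+] --> l m) ->
  forall m t, 0 < t -> f m t = g m t.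
Proof.
move=> df dg fl gl m; elim/ltn_ind: m => m IH t t0.
have dlin (s : R) : is_derive s 1 (fun s => - r 0%N * s) (- r 0%N).
  by rewrite -[X in is_derive _ _ _ X]mulr1; exact: is_deriveZ.
have dE (s : R) : is_derive s 1 (fun s => expR (- r 0%N * s)) (expR (- r 0%N * s) * (- r 0%N)).
  exact: (@is_derive1_comp _ expR (fun s => - r 0%N * s)).
pose D s := expR (- r 0%N * s) * (f m s - g m s).
suff : D t = 0.
  move=> /eqP; rewrite mulf_eq0 expR_eq0/= subr_eq0 => /eqP; exact.
apply: (@derive0_cst D 0 _ _ t t0).
  move=> s s0.
  have h := is_deriveM (dE s) (is_deriveB (df m s s0) (dg m s s0)).
  apply: (is_derive_eq h); rewrite /GRing.scale/= !fctE.
  rewrite -sumrB big_ord_recl/= subn0 big1; first ring.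
  move=> j _; rewrite -mulrBr IH ?subrr ?mulr0//.
  by rewrite /bump/= add1n ltn_subrL/=; case: (m) j => // -[].
rewrite -[X in _ --> X](mulr0 (expR (- r 0%N * 0))); apply: cvgM.
  have ce : {for 0, continuous (fun s => expR (- r 0%N * s))}.
    by have [d _] := dE 0; exact/differentiable_continuous/derivable1_diffP.
  exact: cvg_at_right_filter ce.
by rewrite -[X in _ --> X](subrr (l m)); exact: cvgB (fl m) (gl m).
Qed.

End triangular_system.

(** * The process *)

Section process.
Variables (R : realType) (d : measure_display) (T : measurableType d).
Variables (P : probability T R) (lambda theta alpha : R) (N : R -> {RV P >-> nat}).
Hypotheses (l0 : 0 < lambda) (t0 : 0 < theta) (a0 : 0 < alpha) (a1 : alpha < 1).
Hypothesis NP : tempered_poisson lambda alpha theta N.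
Implicit Types (s h t : R) (i j k m : nat).

Definition prob m t : R := fine (P [set w | N t w = m]).

Lemma measurable_value t (B : set nat) : measurable [set w | B (N t w)].
Proof. by rewrite -[X in measurable X]/(N t @^-1` B); exact: measurable_funPTI. Qed.

Lemma measurable_pair s t (B : nat -> nat -> Prop) :
  measurable [set w | B (N s w) (N t w)].
Proof.
rewrite (_ : [set w | _] = \bigcup_i ([set w | N s w = i] `&` [set w | B i (N t w)])).
  apply: bigcupT_measurable => i; apply: measurableI.
    exact: (measurable_value s [set i]).
  exact: (measurable_value t (B i)).
apply/seteqP; split=> w /=; first by move=> h; exists (N s w).
by move=> [i _ [<-]].
Qed.

Lemma measurable_increment s t (B : set int) :
  measurable [set w | B (increment N s t w)].
Proof. exact: (measurable_pair s t (fun i j => B (j%:Z - i%:Z))). Qed.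

Lemma increment0E h w : increment N 0 h w = (N h w)%:Z.
Proof. by rewrite /increment (tp_start NP) subr0. Qed.

Lemma prob_EFin m t : P [set w | N t w = m] = (prob m t)%:E.
Proof.
rewrite fineK//; apply: fin_num_measure.
exact: (measurable_value t [set m]).
Qed.

Lemma prob_itv m t : 0 <= prob m t <= 1.
Proof.
have mm : measurable [set w | N t w = m] by exact: (measurable_value t [set m]).
rewrite -!lee_fin -prob_EFin measure_ge0/=.
exact: probability_le1.
Qed.

(** Stationarity transfers the law of the increment to N h >= 0, so that the
    increments are nonnegative almost surely. *)
Lemma decrease_null s h : 0 <= s -> 0 <= h ->
  P [set w | increment N s (s + h) w < 0] = 0%E.
Proof.
move=> s0 h0.
rewrite (tp_stationary NP [set z : int | z < 0] s0 h0).
rewrite (_ : [set w | _] = set0) ?measure0//.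
by apply/seteqP; split=> w //=; rewrite increment0E.
Qed.

(** Independence of the increments over [0, s] and [s, s + h], the second one being
    moved to [0, h] by stationarity. *)
Lemma joint_prob s h i j : 0 <= s -> 0 <= h ->
  P [set w | N s w = i /\ increment N s (s + h) w = j%:Z] =
  (prob i s * prob j h)%:E.
Proof.
move=> s0 h0.
(* Times 0, s, s + h; as N starts at 0, the first increment is N s. *)
pose tt k := if k == 0%N then 0 else if k == 1%N then s else s + h.
pose B k : set int := if k == 0%N then [set i%:Z] else [set j%:Z].
have tt0 : 0 <= tt 0%N by [].
have ttS k : (k < 2)%N -> tt k <= tt k.+1.
  by case: k => [|[|]]//= _; rewrite lerDl.
have := tp_independent NP B tt0 ttS.
rewrite (_ : [set w | _] = [set w | N s w = i /\ increment N s (s + h) w = j%:Z]).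
  move=> ->; rewrite big_ord_recl big_ord1 /= /bump /= EFinM -!prob_EFin.
  congr (_ * _)%E.
    congr (P _); apply/seteqP; split=> w /=; rewrite increment0E; first by case.
    by move=> ->.
  rewrite (tp_stationary NP [set j%:Z] s0 h0).
  congr (P _); apply/seteqP; split=> w /=; rewrite increment0E; first by case.
  by move=> ->.
apply/seteqP; split=> w /=.
  move=> H; have := H 0%N isT; have := H 1%N isT.
  by rewrite /B/= increment0E => -> [->].
by move=> [H1 H2] [|[|]]//= _; rewrite /B/= ?increment0E ?H1.
Qed.

(** Split according to the increment j over [s, s + h]; the paths that decrease
    there have probability 0. *)
Lemma prob_convolution s h m : 0 <= s -> 0 <= h ->
  prob m (s + h) = \sum_(j < m.+1) prob (m - j) s * prob j h.
Proof.
move=> s0 h0.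
pose A j := [set w | N s w = (m - j)%N /\ increment N s (s + h) w = j%:Z].
pose Neg := [set w | increment N s (s + h) w < 0].
have mA j : measurable (A j).
  exact: (measurable_pair s (s + h) (fun a b => a = (m - j)%N /\ b%:Z - a%:Z = j%:Z)).
have mNeg : measurable Neg by exact: (measurable_increment s (s + h) [set z | z < 0]).
have mN : measurable [set w | N (s + h) w = m].
  exact: (measurable_value (s + h) [set m]).
have mU : measurable (\big[setU/set0]_(j < m.+1) A j) by exact: bigsetU_measurable.
have N0 := decrease_null s0 h0.
have -> : prob m (s + h) = fine (P (\big[setU/set0]_(j < m.+1) A j)).
  rewrite /prob; congr fine.
  (* Both events become equal once the null set of decreasing paths is added. *)
  rewrite -(measureU0 mN mNeg N0) -(measureU0 mU mNeg N0).
  congr (P _); apply/seteqP; split=> w [|]; try by right.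
    move=> /= Nm; have [neg|pos] := ltP (increment N s (s + h) w) 0; first by right.
    left; rewrite -bigcup_mkord.
    have le : (N s w <= m)%N by move: pos; rewrite /increment Nm; lia.
    exists (m - N s w)%N; first by rewrite /= ltnS leq_subr.
    by rewrite /A/= /increment Nm subKn// subzn.
  rewrite -bigcup_mkord => -[j /= jm [e1 e2]]; left.
  move: e2; rewrite /increment e1; lia.
rewrite measure_semi_additive_ord//.
  rewrite (eq_bigr (fun j : 'I_m.+1 => (prob (m - j) s * prob j h)%:E)).
    by rewrite sumEFin.
  by move=> j _; exact: joint_prob.
apply/trivIsetP => i j _ _ /eqP ij; apply/seteqP; split=> w //= [[_ e1] [_ e2]].
by apply: ij; apply/val_inj => /=; move: e1; rewrite e2 => -[].
Qed.

(** The small-time hypotheses at time 0, with the o(dt) term read as a limit of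
    difference quotients. *)
Lemma jump_limit m :
  h^-1 * (prob m h - (m == 0%N)%:R) @[h --> 0^'+] --> rate lambda theta alpha m.
Proof.
have key (f : R -> R) (b c : R) :
    (forall eps, 0 < eps -> \forall h \near 0^'+, `|f h - (b + h * c)| <= eps * `|h|) ->
    h^-1 * (f h - b) @[h --> 0^'+] --> c.
  move=> H; apply/cvgrPdist_le => e e0; near=> h.
  have h0 : 0 < h by near: h; exact: nbhs_right_gt.
  rewrite distrC -(ler_pM2l h0) -{1}(gtr0_norm h0) -normrM.
  have -> : h * (h^-1 * (f h - b) - c) = f h - (b + h * c) by field; rewrite gt_eqF.
  have -> : h * e = e * `|h| by rewrite gtr0_norm// mulrC.
  by near: h; exact: H.
have probE k h : fine (P [set w | increment N 0 (0 + h) w = k%:Z]) = prob k h.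
  rewrite add0r; congr (fine (P _)).
  apply/seteqP; split=> w /=; rewrite increment0E; first by case.
  by move=> ->.
apply: key => e e0; case: m => [|m]; near=> h.
  rewrite -probE (tp_nojump NP (lexx 0)) (nojump_rateE l0 t0 a0 a1) mulrN opprK.
  rewrite [_ - (_ + _)]addrAC subrr add0r.
  by near: h; exact: littleoP.
rewrite -probE (tp_jump NP (lexx 0) (ltn0Sn m)) (jump_rateE l0 t0 a1)//.
rewrite add0r addrAC subrr add0r.
by near: h; exact: littleoP.
Unshelve. all: by end_near.
Qed.

Lemma prob_start m : prob m t @[t --> 0^'+] --> ((m == 0%N)%:R : R).
Proof.
have h : (m == 0%N)%:R + h * (h^-1 * (prob m h - (m == 0%N)%:R)) @[h --> 0^'+] -->
    (m == 0%N)%:R + 0 * rate lambda theta alpha m.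
  apply: cvgD; first exact: cvg_cst.
  by apply: cvgM; [exact: cvg_at_right_filter|exact: jump_limit].
rewrite mul0r addr0 in h; apply: cvg_trans h.
apply: near_eq_cvg; near=> h.
have h0 : 0 < h by near: h; exact: nbhs_right_gt.
by rewrite /=; field; rewrite gt_eqF.
Unshelve. all: by end_near.
Qed.

(** The coefficient prob (m - j) s stays bounded while the other factor is small
    with h, uniformly in s. *)
Lemma prob_increment s h m : 0 <= s -> 0 <= h ->
  prob m (s + h) - prob m s =
  \sum_(j < m.+1) prob (m - j) s * (prob j h - (j == 0%N :> nat)%:R).
Proof.
move=> s0 h0; rewrite prob_convolution//.
under [RHS]eq_bigr do rewrite mulrBr.
rewrite sumrB; congr (_ - _).
rewrite big_ord_recl/= subn0 mulr1 big1 ?addr0// => j _.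
by rewrite mulr0.
Qed.

Lemma prob_left_continuous m t : 0 < t ->
  prob m (t - h) @[h --> 0^'+] --> prob m t.
Proof.
move=> tgt0.
pose u h := \sum_(j < m.+1) `|prob j h - (j == 0%N :> nat)%:R|.
have u0 : u h @[h --> 0^'+] --> (0 : R).
  rewrite [X in _ --> X](_ : _ = \sum_(j < m.+1) (0 : R)); last by rewrite big1.
  apply: cvg_big => [|j _]; first exact: add_continuous.
  rewrite -[X in _ --> X](@normr0 R R); apply: cvg_norm.
  rewrite -[X in _ --> X](subrr ((j == 0%N :> nat)%:R)).
  by apply: cvgB; [exact: prob_start|exact: cvg_cst].
apply/cvgrPdist_le => e e0.
have /cvgrPdist_le/(_ _ e0) := u0.
move=> H; near=> h.
have h0 : 0 < h by near: h; exact: nbhs_right_gt.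
have ht : h < t by near: h; exact: nbhs_right_lt.
have uh : `|0 - u h| <= e by near: h.
have th0 : 0 <= t - h by rewrite subr_ge0 ltW.
have := prob_increment m th0 (ltW h0); rewrite subrK => ->.
apply: le_trans uh; rewrite sub0r normrN [leRHS]ger0_norm; last exact: sumr_ge0.
apply: (le_trans (ler_norm_sum _ _ _)); apply: ler_sum => j _.
have /andP[p0 p1] := prob_itv (m - j) (t - h).
by rewrite normrM (ger0_norm p0) ler_piMl.
Unshelve. all: by end_near.
Qed.

(** The increment over [t, t + h] has coefficients taken at time t, the one over
    [t - h, t] has them at time t - h: left continuity makes the two one-sided
    derivatives agree. *)
Lemma is_derive_prob m t : 0 < t ->
  is_derive t 1 (prob m) (\sum_(j < m.+1) rate lambda theta alpha j * prob (m - j) t).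
Proof.
move=> tgt0.
set l := (X in is_derive _ _ _ X).
have lE : l = \sum_(j < m.+1) prob (m - j) t * rate lambda theta alpha j.
  by apply: eq_bigr => j _; rewrite mulrC.
suff H : h^-1 * (prob m (h * 1 + t) - prob m t) @[h --> (0 : R)^'] --> (l : R).
  split; first by apply/cvg_ex; exists l.
  exact: cvg_lim H.
have slope s h : 0 <= s -> 0 <= h ->
    h^-1 * (prob m (s + h) - prob m s) =
    \sum_(j < m.+1) prob (m - j) s * (h^-1 * (prob j h - (j == 0%N :> nat)%:R)).
  move=> s0 h0; rewrite prob_increment// mulr_sumr.
  by apply: eq_bigr => j _; rewrite mulrCA.
have E (c : R -> R) : (forall i, prob i (c h) @[h --> 0^'+] --> prob i t) ->
   \sum_(j < m.+1) prob (m - j) (c h) * (h^-1 * (prob j h - (j == 0%N :> nat)%:R))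
     @[h --> 0^'+] --> l.
  move=> c0; rewrite lE; apply: cvg_big => [|j _]; first exact: add_continuous.
  by apply: cvgM => //; exact: jump_limit.
apply: (@cvg_at_right_left_dnbhs _ R^o).
  apply: cvg_trans (E (fun=> t) _); last by move=> i; exact: cvg_cst.
  apply: near_eq_cvg; near=> h.
  have h0 : 0 < h by near: h; exact: nbhs_right_gt.
  by rewrite -(slope t h (ltW tgt0) (ltW h0)) mulr1 [h + t]addrC.
apply/cvg_at_leftNP; rewrite oppr0.
apply: cvg_trans (E (fun h => t - h) _); last by move=> i; exact: prob_left_continuous.
apply: near_eq_cvg; near=> h.
have h0 : 0 < h by near: h; exact: nbhs_right_gt.
have ht : h < t by near: h; exact: nbhs_right_lt.
have th0 : 0 <= t - h by rewrite subr_ge0 ltW.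
rewrite -(slope _ h th0 (ltW h0)) subrK /= mulr1.
by rewrite invrN [- h + t]addrC mulNr -mulrN opprB.
Unshelve. all: by end_near.
Qed.

Lemma probE m t : 0 < t -> prob m t = tempered_pmf lambda theta alpha m t.
Proof.
apply: (@triangular_ode_unique _ (rate lambda theta alpha) (fun m => (m == 0%N)%:R)).
- exact: is_derive_prob.
- by move=> k s _; exact: is_derive_tempered_pmf.
- exact: prob_start.
- move=> k; rewrite -(tempered_pmf_at0 lambda theta alpha k).
  apply: cvg_at_right_filter.
  have [df _] := is_derive_tempered_pmf lambda theta a0 a1 k 0.
  exact/differentiable_continuous/derivable1_diffP.
Qed.

End process.

Unset Implicit Arguments.

Theorem mainTheorem9 (R : realType) (d : measure_display)
    (T : measurableType d) (P : probability T R) (lambda theta alpha : R)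
    (N : R -> {RV P >-> nat}) :
  0 < lambda -> 0 < theta -> 0 < alpha -> alpha < 1 ->
  tempered_poisson lambda alpha theta N ->
  forall (t : R) (m : nat), 0 < t ->
  exists2 S : R,
    series (fun k : nat =>
      (- t * (lambda + theta) `^ alpha) ^+ k / k`!%:R *
      (Gamma (alpha * k%:R + 1) / Gamma (alpha * k%:R + 1 - m%:R))) @ \oo --> S
    & P [set w | N t w = m] =
      ((-1) ^+ m / m`!%:R *
       (lambda ^+ m * expR (theta `^ alpha * t) / (theta + lambda) ^+ m) *
       S)%:E.
Proof.
move=> l0 t0 a0 a1 NP t m tgt0.
pose z := - t * (lambda + theta) `^ alpha.
exists (m`!%:R * egs (fun k => gbin m (alpha * k%:R)) z).
  have := egs_cvg (z := z) (geometric_bound_gbin a0 a1 m).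
  move=> /(cvgM (cvg_cst (m`!%:R : R))); apply: cvg_trans.
  rewrite (_ : series _ = fun n => m`!%:R * pseries (fun k => gbin m (alpha * k%:R) / k`!%:R) z n)//.
  apply/funext => n; rewrite /pseries /series/= mulr_sumr; apply: eq_bigr => k _.
  rewrite Gamma_ratio ?mulr_ge0 ?(ltW a0)// /gbin -/z.
  by field; rewrite !pnatr_eq0 -!lt0n !fact_gt0.
rewrite (prob_EFin N m t) (probE l0 t0 a0 a1 NP m tgt0); congr EFin.
rewrite /tempered_pmf /z addrC.
have -> : - lambda / (lambda + theta) = -1 * lambda / (lambda + theta) by rewrite mulN1r.
rewrite !exprMn exprVn.
by field; rewrite expf_neq0 ?gt_eqF ?addr_gt0 ?ltr0n ?fact_gt0.
Qed.
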